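(* For $s,t\in\mathbb{R}$ and $n\in\mathbb{N}$, $n\ge1$, let $A_n(s,t)=\big[\min\{i,j\}+s+t\,\delta_{i,j}\big]_{i,j=1}^n$. Then \[ \det A_n(s,t)=S_n(1,s+1;t)=S_n(1,1;t)+s\,S_{n-1}(2,1;t). \] Moreover, $A_n(s,t)$ is positive definite (in the sense that all its eigenvalues are nonnegative) if and only if $t>t_n$ and $S_n(1,s+1;t)\ge0$.
   Context: For $a,b\in\mathbb{R}$ the polynomials $S_n(a,b;t)$ in the variable $t$ are defined by $S_0(a,b;t)=1$, $S_1(a,b;t)=at+b$, and $S_n(a,b;t)=(1+2t)S_{n-1}(a,b;t)-t^2S_{n-2}(a,b;t)$ for $n\ge2$. Define $t_1=-\infty$ and $t_n=\dfrac{-1}{2+2\cos(\pi/n)}$ for $n\ge2$. Here $\delta_{i,j}$ is the Kronecker delta, and ''positive definite'' means positive semidefinite: all eigenvalues are $\ge0$. *)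

(* Defs.v *)
From mathcomp Require Import all_boot all_order all_algebra.
From mathcomp Require Import all_classical all_reals all_analysis.

Set Implicit Arguments.
Unset Strict Implicit.
Unset Printing Implicit Defensive.

Import Order.TTheory GRing.Theory Num.Theory.

Local Open Scope ring_scope.

Fixpoint Spoly (R : realType) (a b : R) (n : nat) : {poly R} :=
  match n with
  | 0 => 1
  | 1 => a%:P * 'X + b%:P
  | (m.+1 as k).+1 => (1 + 2 * 'X) * Spoly a b k - 'X^2 * Spoly a b m
  end.

(* The value at n = 0, which has no mathematical meaning, is also -oo. *)
Definition threshold (R : realType) (n : nat) : \bar R :=
  if (n <= 1)%N then -oo%E else (- 1 / (2 + 2 * cos (pi / n%:R)))%:E.

(* Ordinals start at 0, hence the shifts i.+1 and j.+1. *)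
Definition minmx (R : realType) (n : nat) (s t : R) : 'M[R]_n :=
  \matrix_(i < n, j < n) ((minn i.+1 j.+1)%:R + s + t * (i == j)%:R).

(* [eigenvalue] only ranges over R; symmetry guarantees that no complex
   eigenvalue is missed. *)
Definition positive_semidefinite (R : realType) (n : nat) (A : 'M[R]_n) : Prop :=
  A^T = A /\ forall a : R, eigenvalue A a -> 0 <= a.

(* Main.v *)
(* Conjugating A_n(s,t) by the bidiagonal difference matrix D (det D = 1) gives
   a tridiagonal matrix, Toeplitz except for its first diagonal entry; expanding
   along the last row yields the recurrence of S_n(1,s+1;t).

   Since A_n(s,t) - a I = A_n(s,t-a), the matrix is positive semidefinite iff
   P = S_n(1,s+1;.) has no root above t, so no spectral theorem is needed. Put
   T_m = S_m(2,1;.), the Toeplitz determinants; then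
   P(u) = T_n(u) + (s - u) T_{n-1}(u). On the region where T_0, ..., T_{n-1} are
   positive, f_m(u) = T_m(u)/T_{m-1}(u) - u is strictly increasing for m <= n,
   because f_{m+1} - 1 is the parallel sum u f_m/(u + f_m). Hence P(t) >= 0 forces
   P > 0 above t. The region is u > t_n, because at t_n the T_m with m < n-1 are positive and T_{n-1} vanishes, by the closed form
   T_m = r^m sin((m+1) pi/n) / sin(pi/n) with r = -t_n. There P(t_n) < 0, so P,
   being monic, has a root above t_n. *)

Require Import Defs.
From mathcomp Require Import all_boot all_order all_algebra.
From mathcomp Require Import all_classical all_reals all_analysis.
From mathcomp Require Import polyrcf zify ring lra.

Import Order.TTheory GRing.Theory Num.Theory.

Local Open Scope ring_scope.

Set Implicit Arguments.
Unset Strict Implicit.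
Unset Printing Implicit Defensive.

(** * Values and ratios of the polynomials S_n *)

Lemma SpolySS (R : realType) (a b : R) n x :
  (Spoly a b n.+2).[x] =
  (1 + 2 * x) * (Spoly a b n.+1).[x] - x ^+ 2 * (Spoly a b n).[x].
Proof. by rewrite [Spoly a b n.+2]/= !hornerE. Qed.

Lemma Spoly0 (R : realType) (a b x : R) : (Spoly a b 0).[x] = 1.
Proof. by rewrite /= hornerE. Qed.

Lemma Spoly1 (R : realType) (a b x : R) : (Spoly a b 1).[x] = a * x + b.
Proof. by rewrite /= !hornerE. Qed.

Lemma nat_ind2 (P : nat -> Prop) :
  P 0 -> P 1 -> (forall n, P n -> P n.+1 -> P n.+2) -> forall n, P n.
Proof.
move=> P0 P1 PS n; suff: P n /\ P n.+1 by case.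
by elim: n => // n [Pn PSn]; split=> //; apply: PS.
Qed.

Lemma Spoly_split (R : realType) (s x : R) n :
  (Spoly 1 (s + 1) n.+1).[x] = (Spoly 1 1 n.+1).[x] + s * (Spoly 2 1 n).[x].
Proof.
elim/nat_ind2: n => [||n IHn IHSn].
- by rewrite !Spoly1 Spoly0; ring.
- by rewrite !SpolySS !Spoly1 !Spoly0; ring.
by rewrite SpolySS IHn IHSn (SpolySS 1 1 n.+1) (SpolySS 2 1 n); ring.
Qed.

(** The tridiagonal determinant is affine in its first diagonal entry, and s + 1 + x exceeds the
    Toeplitz value 1 + 2x by s - x. *)
Lemma Spoly_toeplitz (R : realType) (s x : R) n :
  (Spoly 1 (s + 1) n.+1).[x] =
  (Spoly 2 1 n.+1).[x] + (s - x) * (Spoly 2 1 n).[x].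
Proof.
elim/nat_ind2: n => [||n IHn IHSn].
- by rewrite !Spoly1 Spoly0; ring.
- by rewrite !SpolySS !Spoly1 !Spoly0; ring.
by rewrite SpolySS IHn IHSn (SpolySS 2 1 n.+1) (SpolySS 2 1 n); ring.
Qed.

(* With a = p - u, the expression u - u^2/p is the parallel sum u a/(u + a). *)
Lemma ratio_step (R : realFieldType) (u v p q : R) :
  0 < p -> u < v -> p - u < q - v -> u - u ^+ 2 / p < v - v ^+ 2 / q.
Proof.
move=> p0 uv pq; have q0 : 0 < q by lra.
rewrite -subr_gt0.
(* With a = p - u and b = q - v, the numerator is u v (b - a) + a b (v - u). It is rewritten with
   squares because u, v, a, b may be negative. *)
have -> : v - v ^+ 2 / q - (u - u ^+ 2 / p) =
  ((p - u) ^+ 2 * (v - u) + u ^+ 2 * ((q - v) - (p - u))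
    + (v - u) * ((q - v) - (p - u)) * p) / (p * q).
  by field; rewrite !gt_eqF.
apply: divr_gt0; last exact: mulr_gt0.
apply: ltr_wpDl; last by rewrite !mulr_gt0 ?subr_gt0.
by rewrite addr_ge0 // mulr_ge0 ?sqr_ge0 ?subr_ge0 // ltW.
Qed.

Lemma toeplitz_ratio (R : realType) (x : R) n :
  (Spoly 2 1 n).[x] != 0 -> (Spoly 2 1 n.+1).[x] != 0 ->
  (Spoly 2 1 n.+2).[x] / (Spoly 2 1 n.+1).[x] =
  1 + 2 * x - x ^+ 2 / ((Spoly 2 1 n.+1).[x] / (Spoly 2 1 n).[x]).
Proof. by rewrite SpolySS => h0 h1; field; apply/andP. Qed.

(** Positivity at [v] comes out of the same induction: the ratio at [v] exceeds the positive ratio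
    at [u] by more than v - u. *)
Lemma toeplitz_ratio_lt (R : realType) (u v : R) n : u < v ->
  (forall k, (k <= n)%N -> 0 < (Spoly 2 1 k).[u]) ->
  0 < (Spoly 2 1 n).[v] /\
  (Spoly 2 1 n.+1).[u] / (Spoly 2 1 n).[u] - u <
  (Spoly 2 1 n.+1).[v] / (Spoly 2 1 n).[v] - v.
Proof.
move=> uv; elim: n => [_|n IHn u_gt0].
  by rewrite !Spoly0 !Spoly1; split; lra.
have [vn_gt0 lt_n] : _ /\ _ := IHn (fun k kn => u_gt0 k (leqW kn)).
have un_gt0 := u_gt0 n (leqnSn n); have uSn_gt0 := u_gt0 n.+1 (leqnn _).
have ru_gt0 : 0 < (Spoly 2 1 n.+1).[u] / (Spoly 2 1 n).[u] by rewrite divr_gt0.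
have rv_gt0 : 0 < (Spoly 2 1 n.+1).[v] / (Spoly 2 1 n).[v] by lra.
have vSn_gt0 : 0 < (Spoly 2 1 n.+1).[v] by move: rv_gt0; rewrite pmulr_lgt0 ?invr_gt0.
split=> //; rewrite !toeplitz_ratio ?gt_eqF //.
by have := ratio_step ru_gt0 uv lt_n; lra.
Qed.

(** With r = 1/(2 + 2 cos th) and x = -r, one has 1 + 2x = 2 r cos th and x^2 = r^2, so the
    recurrence is that of the Chebyshev polynomials of the second kind scaled by r^n. *)
Lemma toeplitz_closed (R : realType) (th : R) n : 0 < 1 + cos th ->
  (Spoly 2 1 n).[- 1 / (2 + 2 * cos th)] * sin th =
  (2 + 2 * cos th) ^- n * sin (n.+1%:R * th).
Proof.
move=> c0; have cN0 : 2 + 2 * cos th != 0 by lra.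
elim/nat_ind2: n => [||n IHn IHSn].
- by rewrite Spoly0 expr0 invr1 !mul1r.
- by rewrite Spoly1 expr1 (mulr_natl th) sin_mulr2n; field.
rewrite SpolySS mulrBl -[_ * _ * sin th]mulrA -[_ ^+ 2 * _ * sin th]mulrA.
rewrite IHn IHSn.
have -> : n.+1%:R * th = n.+2%:R * th - th by rewrite -!natr1; ring.
have -> : n.+3%:R * th = n.+2%:R * th + th by rewrite -!natr1; ring.
rewrite sinB sinD !exprSr; field.
by rewrite cN0 expf_neq0.
Qed.

Lemma monic_root_gt (R : rcfType) (p : {poly R}) x :
  p \is monic -> p.[x] < 0 -> exists2 u, x < u & root p u.
Proof.
move=> /monicP lp px; have [|b pb] := @poly_pinfty_gt_lc _ p.
  by rewrite lp.
have [||u /andP[xu _] pu] := @poly_ivt _ p x (Num.max x b).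
- by rewrite le_max lexx.
- rewrite ltW //= (le_trans _ (pb _ _)) ?lp //.
  by rewrite le_max lexx orbT.
exists u => //; rewrite lt_neqAle xu andbT.
by apply: contraTneq pu => <-; rewrite /root lt_eqF.
Qed.

(** * The determinant of A_n(s,t) *)

Section Determinant.

Variable R : realType.
Implicit Types (s t : R) (f : nat -> nat -> R).

Definition minentry s t (i j : nat) : R :=
  (minn i.+1 j.+1)%:R + s + t * (i == j)%:R.

Definition trid s t (i j : nat) : R :=
  if i == j then (if i is 0 then s + 1 + t else 1 + 2 * t)
  else if (i == j.+1) || (j == i.+1) then - t else 0.

Lemma trid0 s t (i j : nat) : (i.+1 < j)%N || (j.+1 < i)%N -> trid s t i j = 0.
Proof. by move=> h; rewrite /trid !ifF //; apply/negbTE; lia. Qed.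

Lemma det_trid s t n :
  \det (\matrix_(i < n, j < n) trid s t i j) = (Spoly 1 (s + 1) n).[t].
Proof.
elim/nat_ind2: n => [||n IHn IHSn].
- by rewrite det_mx00 Spoly0.
- by rewrite det_mx11 mxE Spoly1 /trid /=; ring.
rewrite SpolySS -IHn -IHSn (expand_det_row _ ord_max).
rewrite !big_ord_recr /= big1 ?add0r => [|i _]; last first.
  rewrite mxE trid0 ?mul0r //=; have := ltn_ord i; lia.
rewrite addrC; congr (_ + _).
  rewrite mxE /trid eqxx /cofactor /= -signr_odd addnn odd_double mul1r.
  congr (_ * \det _); apply/matrixP => i j.
  by rewrite !mxE !lift_max.
(* The minor left of the corner has a single nonzero entry, -t, in its last column; a second
   expansion there leaves the matrix of order n. *)
rewrite mxE /cofactor /= (expand_det_col _ ord_max).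
rewrite big_ord_recr /= big1 ?add0r => [|i _]; last first.
  rewrite !mxE trid0 ?mul0r //= /bump; have := ltn_ord i; lia.
have sgn : (-1) ^+ (n + n) = 1 :> R by rewrite -signr_odd addnn odd_double.
rewrite !mxE /cofactor /= addSn exprS sgn mulr1 mul1r.
set M := row' _ _; set B := \matrix_(_ < n, _ < n) _.
have -> : M = B.
  apply/matrixP => i j; rewrite !mxE /=; congr trid.
    by have /= hi := ltn_ord i; rewrite /bump !(leqNgt n i) hi !add0n ltnNge (ltnW hi).
  by have /= hj := ltn_ord j; rewrite /bump !(leqNgt n j) hj !add0n (leqNgt n j) hj.
have -> : trid s t n.+1 n = - t by rewrite /trid eqxx ifF //; lia.
have -> : trid s t (bump n.+1 n) (bump n n) = - t.
  by rewrite /bump leqnn ltnn /trid add0n add1n eqxx orbT ifF //; lia.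
by ring.
Qed.

Definition diffmx n : 'M[R]_n :=
  \matrix_(i, j) ((i == j)%:R - (i == j.+1 :> nat)%:R).

Lemma det_diffmx n : \det (diffmx n) = 1.
Proof.
rewrite det_trig.
  apply: big1 => i _; rewrite mxE eqxx (_ : (_ == _.+1) = false) ?subr0 //; lia.
apply/is_trig_mxP => i j ij; rewrite mxE -val_eqE /=.
by rewrite !ltn_eqF ?subr0 // ltnW.
Qed.

(** The convention F(-1) = 0 keeps the first row and column undifferenced, whence the exceptional
    corner of [trid]. *)
Definition bdiff (F : nat -> R) (i : nat) : R :=
  F i - (if i is j.+1 then F j else 0).

Lemma sum_diffmx n (i : 'I_n) (F : nat -> R) :
  \sum_(k < n) diffmx n i k * F k = bdiff F i.
Proof.
under eq_bigr do rewrite mxE mulrBl.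
rewrite sumrB; congr (_ - _).
  rewrite (bigD1 i) //= eqxx mul1r big1 ?addr0 // => k /negbTE ki.
  by rewrite eq_sym ki mul0r.
case: i => -[|i] /= hi; first by rewrite big1 // => k _; rewrite mul0r.
rewrite (bigD1 (Ordinal (ltnW hi))) //= eqxx mul1r big1 ?addr0 // => k ki.
rewrite eqSS eq_sym (_ : (_ == _) = false) ?mul0r //.
by apply: negbTE; apply: contraNneq ki => e; apply/eqP/val_inj.
Qed.

Lemma diffmx_conj n (f : nat -> nat -> R) :
  diffmx n *m (\matrix_(i < n, j < n) f i j) *m (diffmx n)^T =
  \matrix_(i < n, j < n) bdiff (fun k => bdiff (f^~ k) i) j.
Proof.
apply/matrixP => i j; rewrite !mxE -sum_diffmx; apply: eq_bigr => k _.
rewrite !mxE mulrC -sum_diffmx; congr (_ * _).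
by apply: eq_bigr => l _; rewrite !mxE.
Qed.

(** The mixed second difference of min is the Kronecker delta, the constant s survives only at the
    corner, and t I becomes t D D^T. *)
Lemma bdiff_minentry s t i j :
  bdiff (fun k => bdiff (minentry s t ^~ k) i) j = trid s t i j.
Proof.
rewrite /bdiff /minentry /trid.
case: i j => [|i] [|j]; rewrite ?minn0 ?min0n ?minnn ?minnSS ?min0n ?minn0 ?eqSS /=.
- by ring.
- by case: j => [|j] /=; ring.
- by case: i => [|i] /=; ring.
have [ij|ji|<-] := ltngtP i j.
- have -> : minn i j.+1 = i by lia.
  have -> : minn i.+1 j = i.+1 by lia.
  have -> : (i == j.+1) = false by lia. rewrite [j == _]eq_sym.
  by case: (i.+1 == j) => /=; ring.
- have -> : minn i j.+1 = j.+1 by lia.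
  have -> : minn i.+1 j = j by lia.
  have -> : (i.+1 == j) = false by lia. have -> : (j == i.+1) = false by lia.
  by case: (i == j.+1) => /=; ring.
have -> : minn i i.+1 = i by lia. have -> : minn i.+1 i = i by lia.
have -> : (i == i.+1) = false by lia. have -> : (i.+1 == i) = false by lia.
by rewrite ?minnn ?eqxx /=; ring.
Qed.

Lemma det_minmx n s t : \det (minmx n s t) = (Spoly 1 (s + 1) n).[t].
Proof.
rewrite -det_trid.
have <- : diffmx n *m minmx n s t *m (diffmx n)^T =
    \matrix_(i < n, j < n) trid s t i j.
  rewrite (diffmx_conj n (minentry s t)).
  by apply/matrixP => i j; rewrite !mxE bdiff_minentry.
by rewrite !det_mulmx det_tr det_diffmx mul1r mulr1.
Qed.

End Determinant.

(** * Eigenvalues as roots of S_n(1,s+1;.) *)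

Lemma minmx_sub_scalar (R : realType) n (s t a : R) :
  minmx n s t - a%:M = minmx n s (t - a).
Proof. by apply/matrixP => i j; rewrite !mxE -mulr_natr; ring. Qed.

Lemma tr_minmx (R : realType) n (s t : R) : (minmx n s t)^T = minmx n s t.
Proof. by apply/matrixP => i j; rewrite !mxE minnC eq_sym. Qed.

Lemma eigenvalue_minmx (R : realType) n (s t a : R) :
  eigenvalue (minmx n s t) a = root (Spoly 1 (s + 1) n) (t - a).
Proof.
rewrite /eigenvalue /eigenspace kermx_eq0 row_free_unit unitmxE unitfE negbK.
by rewrite minmx_sub_scalar det_minmx.
Qed.

Lemma psd_minmx (R : realType) n (s t : R) :
  positive_semidefinite (minmx n s t) <->
  forall u, root (Spoly 1 (s + 1) n) u -> u <= t.
Proof.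
split=> [[_ h] u pu|h].
  by rewrite -subr_ge0 h // eigenvalue_minmx subKr.
split=> [|a]; first exact: tr_minmx.
by rewrite eigenvalue_minmx => /h; lra.
Qed.

Lemma Spoly_monic (R : realType) (s : R) n : Spoly 1 (s + 1) n \is monic.
Proof.
(* The top coefficients obey c_{n+2} = 2 c_{n+1} - c_n, so they stay equal to 1. *)
suff [sz cf] : (size (Spoly 1 (s + 1) n) <= n.+1)%N /\ (Spoly 1 (s + 1) n)`_n = 1.
  have sz_eq : size (Spoly 1 (s + 1) n) = n.+1.
    apply/eqP; rewrite eqn_leq sz ltnNge; apply/negP => /leq_sizeP/(_ n (leqnn n)).
    by rewrite cf => /eqP; rewrite oner_eq0.
  by apply/monicP; rewrite /lead_coef sz_eq.
elim/nat_ind2: n => [||n [szn cfn] [szSn cfSn]].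
- by rewrite size_poly1 coef1.
- rewrite /= mul1r; split; first by rewrite size_XaddC.
  by rewrite coefD coefX coefC addr0.
rewrite (_ : Spoly 1 (s + 1) n.+2 =
  (1 + 2 * 'X) * Spoly 1 (s + 1) n.+1 - 'X^2 * Spoly 1 (s + 1) n) //.
move: (Spoly _ _ n.+1) (Spoly _ _ n) szn cfn szSn cfSn => q p szp cfp szq cfq.
have -> : (1 + 2 * 'X) * q - 'X^2 * p = q + 'X * q + 'X * q - 'X^2 * p by ring.
split.
  apply/leq_sizeP => -[//|[//|j]] nj.
  rewrite !(coefD, coefN, coefXM, coefXnM) /= !subSS subn0.
  rewrite (leq_sizeP _ _ szq j.+1) // (leq_sizeP _ _ szq j.+2) ?(leqW nj) //;
    last exact: ltnW.
  by rewrite (leq_sizeP _ _ szp j) // !addr0 subr0.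
rewrite !(coefD, coefN, coefXM, coefXnM) /= !subSS subn0 cfp cfq.
by rewrite (leq_sizeP _ _ szq n.+2) //; ring.
Qed.

(** * Behaviour at and above t_n *)

Lemma Spoly_threshold (R : realType) n :
  let x : R := - 1 / (2 + 2 * cos (pi / n.+2%:R)) in
  [/\ forall k, (k <= n)%N -> 0 < (Spoly 2 1 k).[x],
     (Spoly 2 1 n.+1).[x] = 0 & x < 0].
Proof.
set th : R := pi / n.+2%:R => x.
have th_gt0 : 0 < th by rewrite divr_gt0 ?pi_gt0.
have c_gt0 : 0 < 1 + cos th.
  have : 0 <= cos th; last lra.
  apply: cos_ge0_pihalf.
  rewrite (le_trans _ (ltW th_gt0)) ?oppr_le0 ?divr_ge0 ?pi_ge0 //=.
  by rewrite ler_pM2l ?pi_gt0 // lef_pV2 ?posrE // ler_nat.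
have x_lt0 : x < 0 by rewrite /x mulN1r oppr_lt0 invr_gt0; lra.
(* The angle stays strictly below pi for k <= n and equals pi at k = n + 1, where the sine
   vanishes. *)
have sin_gt0 k : (k <= n)%N -> 0 < sin (k.+1%:R * th).
  move=> kn; apply: sin_gt0_pi; rewrite mulr_gt0 //= mulrCA -ltr_pdivlMl ?pi_gt0 //.
  by rewrite mulVf ?gt_eqF ?pi_gt0 // ltr_pdivrMr // mul1r ltr_nat ltnS.
have s0 : 0 < sin th by have := sin_gt0 0 isT; rewrite mul1r.
split=> // [k kn|].
  rewrite -(pmulr_lgt0 _ s0) toeplitz_closed //.
  by rewrite mulr_gt0 ?sin_gt0 // invr_gt0 exprn_gt0 //; lra.
apply: (mulIf (lt0r_neq0 s0)); rewrite toeplitz_closed // mul0r.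
by rewrite mulrCA mulfV ?mulr1 ?sinpi ?mulr0 // pnatr_eq0.
Qed.

(** As T_{n+1} vanishes at this point x, the term in s drops out and the value is -x^2 T_n(x). *)
Lemma Spoly_threshold_lt0 (R : realType) n (s : R) :
  (Spoly 1 (s + 1) n.+2).[- 1 / (2 + 2 * cos (pi / n.+2%:R))] < 0.
Proof.
have [gt0 eq0 lt0] := Spoly_threshold R n.
rewrite Spoly_toeplitz SpolySS eq0 !mulr0 addr0 sub0r oppr_lt0.
by apply: mulr_gt0; [rewrite exprn_even_gt0 ?(lt_eqF lt0) | exact: gt0].
Qed.

Lemma toeplitz_gt0 (R : realType) n (t : R) : (threshold R n.+1 < t%:E)%E ->
  forall k, (k <= n)%N -> 0 < (Spoly 2 1 k).[t].
Proof.
case: n => [_ [|//] _|n]; first by rewrite Spoly0.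
rewrite /threshold /= lte_fin => xt.
have [gt0 eq0 _] := Spoly_threshold R n; set x := - 1 / _ in xt gt0 eq0.
move=> k; rewrite leq_eqVlt ltnS => /predU1P[->|kn]; last first.
  by have [|] := toeplitz_ratio_lt xt (n := k); first by move=> i /leq_trans/(_ kn)/gt0.
(* For the top index the ratio at x is 0, so the ratio at t exceeds t - x > 0. *)
have [t_gt0] := toeplitz_ratio_lt xt gt0.
rewrite eq0 mul0r sub0r => ht.
have inv_gt0 : 0 < (Spoly 2 1 n).[t]^-1 by rewrite invr_gt0.
by rewrite -(pmulr_lgt0 _ inv_gt0); lra.
Qed.

Theorem theorem3p1 (R : realType) (n : nat) (s t : R) (hn : (1 <= n)%N) :
  [/\ \det (minmx n s t) = (Spoly 1 (s + 1) n).[t],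
      (Spoly 1 (s + 1) n).[t] = (Spoly 1 1 n).[t] + s * (Spoly 2 1 n.-1).[t]
    & positive_semidefinite (minmx n s t) <->
      (threshold R n < t%:E)%E /\ 0 <= (Spoly 1 (s + 1) n).[t]].
Proof.
case: n hn => // n _; split; [exact: det_minmx|exact: Spoly_split|].
rewrite psd_minmx; split=> [roots_le|[lt_t Pt_ge0] u Pu0].
  have Px_ge0 x : t <= x -> 0 <= (Spoly 1 (s + 1) n.+1).[x].
    move=> tx; rewrite leNgt; apply/negP => /(monic_root_gt (Spoly_monic s n.+1))[u xu].
    by move=> /roots_le; lra.
  split; last exact: Px_ge0.
  case: n {roots_le} Px_ge0 => [|n] Px_ge0; first by rewrite /threshold ltNyr.
  rewrite /threshold /= lte_fin ltNge; apply/negP => /Px_ge0.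
  by rewrite leNgt Spoly_threshold_lt0.
rewrite leNgt; apply/negP => tu.
have t_gt0 := toeplitz_gt0 lt_t.
have [un_gt0 lt_tu] := toeplitz_ratio_lt tu t_gt0.
have tn_gt0 := t_gt0 n (leqnn n).
(* After division by T_n > 0, the sign of P is that of f_{n+1} + s, which is nonnegative at t and
   strictly larger at u, so u is no root. *)
have ratioE x : 0 < (Spoly 2 1 n).[x] -> (Spoly 1 (s + 1) n.+1).[x] =
    (Spoly 2 1 n).[x] * ((Spoly 2 1 n.+1).[x] / (Spoly 2 1 n).[x] - x + s).
  by move=> x_gt0; rewrite Spoly_toeplitz; field; rewrite gt_eqF.
move: Pt_ge0 Pu0; rewrite /root !ratioE // pmulr_rge0 // mulf_eq0 gt_eqF //=.
by move=> ? /eqP; lra.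
Qed.
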